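(* Let $A$ be a $B(\ell_2)$-embeddable uniform algebra. If $K(A)=\{0\}$, then $A$ is universally $\bigl(B(\ell_2)\setminus\mathcal{K}(\ell_2)\bigr)$-embeddable. Moreover, if (in addition) $A$ is non-unital, then $A$ is universally $\bigl(B(\ell_2)\setminus\widetilde{\mathcal{K}}(\ell_2)\bigr)$-embeddable.
   Context: All algebras are associative and complex; $B(\ell_2)$ is the $C^*$-algebra of bounded operators on the complex Hilbert space $\ell_2(\mathbb{N})$, $\mathcal{K}(\ell_2)$ the ideal of compact operators, and $\widetilde{\mathcal{K}}(\ell_2)=\mathcal{K}(\ell_2)\oplus\mathbb{C}1$ with $1$ the identity operator. A uniform algebra is a commutative Banach algebra $A$ (not necessarily unital) with $\|a^2\|=\|a\|^2$ for all $a\in A$. An element $a$ of a Banach algebra $A$ is compact if the operator $A\to A$, $x\mapsto axa$, is compact; $K(A)$ is the set of compact elements of $A$. A $B(\ell_2)$-embedding of a uniform algebra $A$ is an isometric (hence injective) algebra homomorphism $\phi\colon A\to B(\ell_2)$; $A$ is $B(\ell_2)$-embeddable if one exists. For $Y\subset B(\ell_2)$, $A$ is universally $(B(\ell_2)\setminus Y)$-embeddable if there is a $B(\ell_2)$-embedding $\phi$ of $A$ with $\phi(A)\cap Y=\{0\}$ and every $B(\ell_2)$-embedding $\phi$ of $A$ satisfies $\phi(A)\cap Y=\{0\}$. *)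

(* Defs.v *)
From HB Require Import structures.
From mathcomp Require Import all_boot all_order all_algebra.
From mathcomp Require Import all_classical all_reals topology normedtype sequences.
From mathcomp Require Import complex.

Set Implicit Arguments.
Unset Strict Implicit.
Unset Printing Implicit Defensive.

Import Order.TTheory GRing.Theory Num.Theory.
Import numFieldNormedType.Exports.

Local Open Scope classical_set_scope.
Local Open Scope ring_scope.
Local Open Scope complex_scope.

(* MathComp's ring structures are all unital, hence the following hierarchy of
   associative, not necessarily unital, algebras carrying a submultiplicative
   norm. *)
HB.mixin Record NormedModule_isNormedAlgebra (K : numFieldType) A
    & NormedModule K A := {
  amul : A -> A -> A ;
  amulA : associative amul ;
  amulDl : left_distributive amul +%R ;
  amulDr : right_distributive amul +%R ;
  amulZl : forall (k : K) (a b : A), amul (k *: a) b = k *: amul a b ;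
  amulZr : forall (k : K) (a b : A), amul a (k *: b) = k *: amul a b ;
  normrM_le : forall a b : A, `|amul a b| <= `|a| * `|b|
}.

#[short(type="normedAlgType")]
HB.structure Definition NormedAlgebra (K : numFieldType) :=
  {A of NormedModule K A & NormedModule_isNormedAlgebra K A}.

#[short(type="banachAlgType")]
HB.structure Definition BanachAlgebra (K : numFieldType) :=
  {A of CompleteNormedModule K A & NormedModule_isNormedAlgebra K A}.

HB.mixin Record BanachAlgebra_isUniform (K : numFieldType) A
    & BanachAlgebra K A := {
  amulC : commutative (amul : A -> A -> A) ;
  norm_amul_sqr : forall a : A, `|amul a a| = `|a| ^+ 2
}.

#[short(type="uniformAlgType")]
HB.structure Definition UniformAlgebra (K : numFieldType) :=
  {A of BanachAlgebra K A & BanachAlgebra_isUniform K A}.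

Notation "a ** b" := (amul a b) (at level 40, left associativity) : ring_scope.

Definition unital (K : numFieldType) (A : normedAlgType K) :=
  exists e : A, forall a : A, e ** a = a /\ a ** e = a.

(* Norms of modules over R[i] take their values in R[i]; rnorm is the same norm
   with values in R (see rnormE). *)
Section rnorm.
Context (R : realType).

Definition rnorm (V : normedZmodType R[i]) (v : V) : R := complex.Re `|v|.

Lemma rnormE (V : normedZmodType R[i]) (v : V) : (rnorm v)%:C = `|v|.
Proof.
rewrite /rnorm; have := normr_ge0 v; case: `|v| => a b.
by rewrite lecE /= => /andP[/eqP->].
Qed.

Lemma rnorm_ge0 (V : normedZmodType R[i]) (v : V) : 0 <= rnorm v.
Proof. by rewrite -ler0c rnormE. Qed.

Lemma ler_rnormD (V : normedZmodType R[i]) (u v : V) :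
  rnorm (u + v) <= rnorm u + rnorm v.
Proof. by rewrite -lecR rmorphD /= !rnormE ler_normD. Qed.

Lemma rnorm0 (V : normedZmodType R[i]) : rnorm (0 : V) = 0.
Proof. by rewrite /rnorm normr0. Qed.

Lemma rnormN (V : normedZmodType R[i]) (v : V) : rnorm (- v) = rnorm v.
Proof. by rewrite /rnorm normrN. Qed.

Lemma rnorm0_eq0 (V : normedZmodType R[i]) (v : V) : rnorm v = 0 -> v = 0.
Proof. by move=> v0; apply/normr0_eq0; rewrite -rnormE v0. Qed.

Lemma rnormM (x y : R[i]) : rnorm (x * y) = rnorm x * rnorm y.
Proof. by apply: complexI; rewrite rmorphM /= !rnormE normrM. Qed.

Lemma rnormZ (V : normedModType R[i]) (k : R[i]) (v : V) :
  rnorm (k *: v) = rnorm k * rnorm v.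
Proof. by apply: complexI; rewrite rmorphM /= !rnormE normrZ. Qed.

End rnorm.

Definition compact_operator (R : realType) (V W : normedModType R[i])
    (f : V -> W) : Prop :=
  compact (closure (f @` [set x | `|x| <= 1])).

Section ell2.
Context (R : realType).
Implicit Types x y : nat -> R[i].

Definition sqsums x : R^nat := series (fun n => rnorm (x n) ^+ 2).

Definition in_ell2 : {pred nat -> R[i]} := fun x => `[< cvgn (sqsums x) >].

Definition ell2norm x : R := Num.sqrt (limn (sqsums x)).

Lemma sqsumsS x n : sqsums x n.+1 = sqsums x n + rnorm (x n) ^+ 2.
Proof. by rewrite /sqsums /series /= big_nat_recr. Qed.

Lemma sqsums_ge0 x n : 0 <= sqsums x n.
Proof. by apply: sumr_ge0 => i _; exact: sqr_ge0. Qed.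

Lemma sqsums_nd x : nondecreasing_seq (sqsums x).
Proof.
by apply/nondecreasing_seqP => n; rewrite sqsumsS lerDl sqr_ge0.
Qed.

Lemma sqrt_minkowski (a b c d : R) :
  Num.sqrt ((a + b) ^+ 2 + (c + d) ^+ 2) <=
  Num.sqrt (a ^+ 2 + c ^+ 2) + Num.sqrt (b ^+ 2 + d ^+ 2).
Proof.
have := ler_normD (Complex a c) (Complex b d).
by rewrite !normc_def /= -rmorphD lecR.
Qed.

Lemma sqsums_minkowski x y n :
  Num.sqrt (sqsums (x + y) n) <= Num.sqrt (sqsums x n) + Num.sqrt (sqsums y n).
Proof.
elim: n => [|n IH].
  by rewrite /sqsums /series /= !big_geq // sqrtr0 addr0.
rewrite !sqsumsS.
rewrite -[sqsums x n]sqr_sqrtr ?sqsums_ge0 // -[sqsums y n]sqr_sqrtr ?sqsums_ge0 //.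
apply: le_trans (sqrt_minkowski _ _ _ _).
rewrite ler_sqrt ?addr_ge0 ?sqr_ge0 //; apply: lerD.
  rewrite -[leLHS]sqr_sqrtr ?sqsums_ge0 // ler_sqr ?nnegrE ?addr_ge0 ?sqrtr_ge0 //.
by rewrite ler_sqr ?nnegrE ?addr_ge0 ?rnorm_ge0 ?ler_rnormD.
Qed.

Lemma sqsums_le_lim x n : in_ell2 x -> sqsums x n <= limn (sqsums x).
Proof. by move=> /asboolP cx; exact: (nondecreasing_cvgn_le (@sqsums_nd x) cx n). Qed.

Lemma ell2norm_ub x (M : R) : 0 <= M ->
  (forall n, Num.sqrt (sqsums x n) <= M) -> in_ell2 x /\ ell2norm x <= M.
Proof.
move=> M0 xM; have xM2 n : sqsums x n <= M ^+ 2.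
  by rewrite -[leLHS]sqr_sqrtr ?sqsums_ge0 // ler_sqr ?nnegrE ?sqrtr_ge0.
have cx : cvgn (sqsums x).
  apply: nondecreasing_is_cvgn; first exact: sqsums_nd.
  by exists (M ^+ 2) => _ [n _ <-].
split; first exact/asboolP.
rewrite -[M]ger0_norm // -sqrtr_sqr ler_sqrt ?sqr_ge0 //.
by apply: limr_le => //; near=> n.
Unshelve. all: by end_near. Qed.

Lemma sqrt_sqsums_le x n : in_ell2 x -> Num.sqrt (sqsums x n) <= ell2norm x.
Proof.
move=> lx; rewrite ler_sqrt ?sqsums_le_lim //.
exact: le_trans (sqsums_ge0 x n) (sqsums_le_lim _ lx).
Qed.

Lemma ell2normD x y : in_ell2 x -> in_ell2 y ->
  in_ell2 (x + y) /\ ell2norm (x + y) <= ell2norm x + ell2norm y.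
Proof.
move=> lx ly; apply: ell2norm_ub; first by rewrite addr_ge0 ?sqrtr_ge0.
move=> n; apply: le_trans (sqsums_minkowski x y n) _.
by rewrite lerD ?sqrt_sqsums_le.
Qed.

Lemma sqsumsZ (k : R[i]) x : sqsums (k *: x) = rnorm k ^+ 2 *: sqsums x.
Proof.
apply/funext => n.
rewrite -[RHS]/(rnorm k ^+ 2 * sqsums x n) /sqsums /series /= mulr_sumr.
by apply: eq_bigr => i _; rewrite -exprMn -rnormM.
Qed.

Lemma ell2normZ (k : R[i]) x : in_ell2 x ->
  in_ell2 (k *: x) /\ ell2norm (k *: x) = rnorm k * ell2norm x.
Proof.
move=> /asboolP cx; split; first by apply/asboolP; rewrite sqsumsZ; exact: is_cvgZr.
rewrite /ell2norm sqsumsZ limZr // sqrtrM ?sqr_ge0 // sqrtr_sqr ger0_norm //.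
exact: rnorm_ge0.
Qed.

Lemma ell2_submod_closed : submod_closed in_ell2.
Proof.
split.
  by have [] := @ell2norm_ub 0 0 (lexx _); first by
    move=> n; rewrite /sqsums /series /= big1 ?sqrtr0 // => i _; rewrite rnorm0 expr0n.
by move=> k x y lx ly; have [] := ell2normD (proj1 (ell2normZ k lx)) ly.
Qed.

HB.instance Definition _ :=
  GRing.isSubmodClosed.Build R[i] (nat -> R[i]) in_ell2 ell2_submod_closed.

Record ell2 := Ell2 { ell2_val :> nat -> R[i] ; _ : ell2_val \in in_ell2 }.

HB.instance Definition _ := [isSub for ell2_val].
HB.instance Definition _ := [Choice of ell2 by <:].
HB.instance Definition _ := [SubChoice_isSubLmodule of ell2 by <:].

Lemma ell2P (x : ell2) : in_ell2 x. Proof. exact: (valP x). Qed.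

Let norm (x : ell2) : R[i] := (ell2norm x)%:C.

Let norm_triangle (x y : ell2) : norm (x + y) <= norm x + norm y.
Proof.
by rewrite /norm -rmorphD lecR; have [] := ell2normD (ell2P x) (ell2P y).
Qed.

Let normZ (k : R[i]) (x : ell2) : norm (k *: x) = `|k| * norm x.
Proof.
by rewrite /norm -rnormE -rmorphM /=; have [_ ->] := ell2normZ k (ell2P x).
Qed.

Let norm_eq0 (x : ell2) : norm x = 0 -> x = 0.
Proof.
move=> /complexI x0; apply/val_inj/funext => n /=; apply: rnorm0_eq0.
have := sqrt_sqsums_le n.+1 (ell2P x).
rewrite x0 sqsumsS => h.
have : sqsums x n + rnorm (x n) ^+ 2 <= 0.
  by rewrite -sqrtr_eq0 eq_le h sqrtr_ge0.
move=> h2; apply/eqP; rewrite -sqrf_eq0 eq_le sqr_ge0 andbT.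
by apply: le_trans h2; rewrite lerDr sqsums_ge0.
Qed.

HB.instance Definition _ :=
  Lmodule_isNormed.Build R[i] ell2 norm_triangle normZ norm_eq0.

End ell2.

Section bounded_operators.
Context (R : realType) (V : normedModType R[i]).
Implicit Types f g : V -> V.

Definition is_bounded_operator : {pred V -> V} := fun f =>
  `[< linear f /\ exists M : R, forall x, rnorm (f x) <= M * rnorm x >].

Definition opnorm f : R := sup [set rnorm (f x) | x in [set x | `|x| <= 1]].

Lemma bounded_operator_submod_closed : submod_closed is_bounded_operator.
Proof.
split.
  apply/asboolP; split=> [a u v|]; first by rewrite /= scaler0 addr0.
  by exists 0 => x; rewrite /= rnorm0 mul0r.
move=> k f g /asboolP[lf [M fM]] /asboolP[lg [N gN]]; apply/asboolP; split.
  move=> a u v.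
  rewrite -[LHS]/(k *: f (a *: u + v) + g (a *: u + v)).
  rewrite -[RHS]/(a *: (k *: f u + g u) + (k *: f v + g v)).
  by rewrite lf lg !scalerDr !scalerA (mulrC k a) addrACA.
exists (rnorm k * M + N) => x; apply: le_trans (ler_rnormD _ _) _.
rewrite mulrDl lerD ?gN // rnormZ -mulrA.
by apply: ler_wpM2l (fM x); exact: rnorm_ge0.
Qed.

HB.instance Definition _ := GRing.isSubmodClosed.Build R[i] (V -> V)
  is_bounded_operator bounded_operator_submod_closed.

Record bop :=
  Bop { bop_val :> V -> V ; _ : bop_val \in is_bounded_operator }.

HB.instance Definition _ := [isSub for bop_val].
HB.instance Definition _ := [Choice of bop by <:].
HB.instance Definition _ := [SubChoice_isSubLmodule of bop by <:].

Lemma bopP (T : bop) :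
  linear T /\ exists M : R, forall x, rnorm (T x) <= M * rnorm x.
Proof. exact/asboolP/(valP T). Qed.

Lemma bop0 (T : bop) : T 0 = 0.
Proof.
have [_ [M TM]] := bopP T; apply: rnorm0_eq0; apply/eqP.
by rewrite eq_le rnorm_ge0 andbT; have := TM 0; rewrite rnorm0 mulr0.
Qed.

Lemma bopZ (T : bop) (k : R[i]) (x : V) : T (k *: x) = k *: T x.
Proof. by have [lT _] := bopP T; have := lT k x 0; rewrite bop0 !addr0. Qed.

Lemma opnorm_has_sup (T : bop) :
  has_sup [set rnorm (T x) | x in [set x | `|x| <= 1]].
Proof.
split; first by exists (rnorm (T 0)); exists 0 => //=; rewrite normr0 ler01.
have [_ [M TM]] := bopP T; exists `|M| => _ [x /= x1 <-].
have x1' : rnorm x <= 1 by rewrite -lecR rnormE.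
apply: le_trans (TM x) _; apply: le_trans (_ : `|M| * rnorm x <= _).
  by apply: ler_wpM2r (ler_norm M); exact: rnorm_ge0.
by rewrite -[leRHS]mulr1 ler_wpM2l.
Qed.

Lemma opnorm_ge (T : bop) (x : V) : `|x| <= 1 -> rnorm (T x) <= opnorm T.
Proof. by move=> x1; apply: ub_le_sup; [have [] := opnorm_has_sup T|exists x]. Qed.

Lemma opnorm_le (T : bop) (M : R) :
  (forall x, `|x| <= 1 -> rnorm (T x) <= M) -> opnorm T <= M.
Proof.
move=> TM; apply: ge_sup; first by have [] := opnorm_has_sup T.
by move=> _ [x /= x1 <-]; exact: TM.
Qed.

Lemma opnorm_ge0 (T : bop) : 0 <= opnorm T.
Proof.
by apply: le_trans (opnorm_ge T (x := 0) _); rewrite ?rnorm_ge0 // normr0 ler01.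
Qed.

Lemma opnormP (T : bop) (x : V) : rnorm (T x) <= opnorm T * rnorm x.
Proof.
have [->|x0] := eqVneq x 0; first by rewrite bop0 rnorm0 mulr0.
have nx : 0 < rnorm x.
  by rewrite lt_def rnorm_ge0 andbT; apply: contraNneq x0 => /rnorm0_eq0 ->.
have := @opnorm_ge T ((rnorm x)^-1%:C *: x).
have nk : rnorm ((rnorm x)^-1%:C) = (rnorm x)^-1.
  by apply: complexI; rewrite rnormE ger0_norm // ler0c invr_ge0 ltW.
rewrite bopZ rnormZ nk -rnormE rnormZ nk mulVf ?gt_eqF // lecR lexx => /(_ isT).
by rewrite mulrC ler_pdivrMr.
Qed.

Let norm (T : bop) : R[i] := (opnorm T)%:C.

Let norm_triangle (S T : bop) : norm (S + T) <= norm S + norm T.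
Proof.
rewrite /norm -rmorphD lecR; apply: opnorm_le => x x1 /=.
by apply: le_trans (ler_rnormD _ _) _; rewrite lerD ?opnorm_ge.
Qed.

Let opnormZ_le (k : R[i]) (T : bop) : opnorm (k *: T : bop) <= rnorm k * opnorm T.
Proof.
apply: opnorm_le => x x1 /=; rewrite rnormZ.
by apply: ler_wpM2l; [exact: rnorm_ge0|exact: opnorm_ge].
Qed.

Let normZ (k : R[i]) (T : bop) : norm (k *: T) = `|k| * norm T.
Proof.
rewrite /norm -rnormE -rmorphM; congr _%:C; apply/eqP.
rewrite eq_le opnormZ_le andTb.
have [->|k0] := eqVneq k 0.
  rewrite rnorm0 mul0r. exact: opnorm_ge0.
have nk : 0 < rnorm k.
  by rewrite lt_def rnorm_ge0 andbT; apply: contraNneq k0 => /rnorm0_eq0 ->.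
rewrite mulrC -ler_pdivlMr // mulrC.
have -> : (rnorm k)^-1 = rnorm k^-1.
  have nk0 : rnorm k != 0 by rewrite gt_eqF.
  apply: (mulfI nk0); rewrite -rnormM !mulfV //.
  by apply: complexI; rewrite rnormE normr1.
by apply: le_trans (opnormZ_le _ _); rewrite scalerA mulVf // scale1r.
Qed.

Let norm_eq0 (T : bop) : norm T = 0 -> T = 0.
Proof.
move=> /complexI T0; apply/val_inj/funext => x /=; apply: rnorm0_eq0; apply/eqP.
by rewrite eq_le rnorm_ge0 andbT; have := opnormP T x; rewrite T0 mul0r.
Qed.

HB.instance Definition _ :=
  Lmodule_isNormed.Build R[i] bop norm_triangle normZ norm_eq0.

Lemma bop_normE (T : bop) : `|T| = (opnorm T)%:C.
Proof. by []. Qed.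

Lemma bop_comp_subproof (S T : bop) :
  ((S : V -> V) \o T) \in is_bounded_operator.
Proof.
have [lS _] := bopP S; have [lT _] := bopP T; apply/asboolP; split.
  by move=> a u v /=; rewrite lT lS.
exists (opnorm S * opnorm T) => x /=; apply: le_trans (opnormP _ _) _.
by rewrite -mulrA ler_wpM2l ?opnorm_ge0 ?opnormP.
Qed.

Definition bop_comp (S T : bop) : bop := Bop (bop_comp_subproof S T).

Lemma bop_id_subproof : idfun \in is_bounded_operator.
Proof. by apply/asboolP; split=> //; exists 1 => x; rewrite mul1r. Qed.

Definition bop_id : bop := Bop bop_id_subproof.

Let compA : associative bop_comp.
Proof. by move=> S T U; exact: val_inj. Qed.

Let compDl : left_distributive bop_comp +%R.
Proof. by move=> S T U; exact: val_inj. Qed.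

Let compDr : right_distributive bop_comp +%R.
Proof.
move=> S T U; apply/val_inj/funext => x /=.
by have [lS _] := bopP S; have := lS 1 (T x) (U x); rewrite !scale1r.
Qed.

Let compZl (k : R[i]) (S T : bop) : bop_comp (k *: S) T = k *: bop_comp S T.
Proof. exact: val_inj. Qed.

Let compZr (k : R[i]) (S T : bop) : bop_comp S (k *: T) = k *: bop_comp S T.
Proof. by apply/val_inj/funext => x /=; exact: bopZ. Qed.

Let norm_comp (S T : bop) : `|bop_comp S T| <= `|S| * `|T|.
Proof.
rewrite !bop_normE -rmorphM lecR; apply: opnorm_le => x x1 /=.
apply: le_trans (opnormP _ _) _.
by rewrite ler_wpM2l ?opnorm_ge0 ?opnorm_ge.
Qed.

HB.instance Definition _ := NormedModule_isNormedAlgebra.Build R[i] bop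
  compA compDl compDr compZl compZr norm_comp.

End bounded_operators.

Section embeddings.
Context (R : realType).

Definition Bell2 : normedAlgType R[i] := bop (ell2 R).

Definition Kell2 : set Bell2 := [set T : bop (ell2 R) | compact_operator T].

Definition Kell2_tilde : set Bell2 :=
  [set S + k *: bop_id (ell2 R) | S in Kell2 & k in [set: R[i]]].

Definition compact_elements (A : banachAlgType R[i]) : set A :=
  [set a | compact_operator (fun x : A => a ** x ** a)].

Definition is_Bell2_embedding (A : uniformAlgType R[i]) (phi : A -> Bell2) :=
  [/\ linear phi, {morph phi : a b / a ** b} & forall a, `|phi a| = `|a| ].

Definition Bell2_embeddable (A : uniformAlgType R[i]) :=
  exists phi : A -> Bell2, is_Bell2_embedding phi.

(* Y is the set to be avoided: this is universal (B(l2) \ Y)-embeddability. *)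
Definition universally_embeddable_off (Y : set Bell2)
    (A : uniformAlgType R[i]) :=
  (exists phi : A -> Bell2,
     is_Bell2_embedding phi /\ range phi `&` Y = [set 0]) /\
  (forall phi : A -> Bell2,
     is_Bell2_embedding phi -> range phi `&` Y = [set 0]).

End embeddings.

Arguments Kell2 R : clear implicits.
Arguments Kell2_tilde R : clear implicits.
Arguments compact_elements {R} A.

(* Main.v *)
Require Import Defs.
From mathcomp Require Import all_boot all_order all_algebra ring.
From mathcomp Require Import all_classical all_reals topology normedtype sequences.
From mathcomp Require Import complex.

Set Implicit Arguments.
Unset Strict Implicit.
Unset Printing Implicit Defensive.

Import Order.TTheory GRing.Theory Num.Theory.
Import numFieldNormedType.Exports.

Local Open Scope classical_set_scope.
Local Open Scope ring_scope.
Local Open Scope complex_scope.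

(** The first claim holds because compactness of an element of A can be read
    off from any isometric representation.  If T = phi a is a compact operator,
    then the set of all T S T with S in the unit ball of the operators is
    relatively compact for the operator norm (Vala's theorem), and it contains
    phi (a x a) for every x in the unit ball of A.  As phi is isometric and A is
    complete, the elements a x a form a relatively compact subset of A, so a
    belongs to K(A) = {0}.  This is [compact_element_of_compact_image], and the
    Arzela-Ascoli type argument behind it is [compact_dominated_operators].

    For the second claim, suppose that phi a = S + k 1 with S compact.  If k = 0
    the first claim gives a = 0.  Otherwise, for each b the element b a - k b is
    sent to (phi b) S, which is compact; hence b a = k b by the first claim, and
    a / k is a unit of A ([unital_of_mod_compact_scalar]).  So k <> 0 cannot
    occur in a non-unital algebra. *)

Lemma bopB (R : realType) (V : normedModType R[i]) (T : bop V) :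
  {morph T : x y / x - y}.
Proof.
move=> x y; have [lT _] := bopP T.
by rewrite addrC -[- y]scaleN1r lT scaleN1r addrC.
Qed.

Lemma bop_norm_le (R : realType) (V : normedModType R[i]) (T : bop V) (x : V) :
  `|T x| <= `|T| * `|x|.
Proof. by rewrite bop_normE -!rnormE -rmorphM lecR opnormP. Qed.

(** The order of the complex numbers is partial, so the real-valued
    [opnorm_le] applies once M is known to be real: it bounds a norm. *)
Lemma bop_norm_bound (R : realType) (V : normedModType R[i]) (T : bop V)
    (M : R[i]) : (forall x, `|x| <= 1 -> `|T x| <= M) -> `|T| <= M.
Proof.
move=> TM; have M0 : 0 <= M.
  by apply: le_trans (TM 0 _); rewrite ?normr_ge0 // normr0 ler01.
have /complex_realP[m Mm] := ger0_real M0.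
rewrite Mm bop_normE lecR; apply: opnorm_le => x x1.
by rewrite -lecR rnormE -Mm TM.
Qed.

Lemma dist_le_continuous (K : numFieldType) (V W : normedModType K)
    (f : V -> W) (M : K) :
  0 <= M -> (forall x y, `|f x - f y| <= M * `|x - y|) -> continuous f.
Proof.
move=> M0 fM x; apply/cvgrPdist_lt => e e0.
have M1 : 0 < M + 1 by rewrite ltr_wpDl.
near=> y; apply: le_lt_trans (fM _ _) _.
have : `|x - y| < e / (M + 1).
  by near: y; apply: cvgr_dist_lt; [exact: cvg_id|exact: divr_gt0].
rewrite ltr_pdivlMr // mulrC; apply: le_lt_trans.
by rewrite ler_wpM2r // lerDl.
Unshelve. all: by end_near. Qed.

Lemma closed_norm_le (K : numFieldType) (V : normedModType K) (M : K) :
  0 <= M -> closed [set v : V | `|v| <= M].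
Proof.
move=> M0 v clv /=.
have vM : `|v| >=< M by rewrite real_comparable ?ger0_real.
rewrite comparable_leNgt //; apply/negP => Mv.
have [|w [/= wM]] := clv [set w | M < `|w|].
  exact: (cvgr_norm_gt v (@cvg_id _ (nbhs v)) M Mv).
by move/(le_lt_trans wM); rewrite ltxx.
Qed.

Lemma bop_continuous (R : realType) (V : normedModType R[i]) (T : bop V) :
  continuous T.
Proof.
apply: (@dist_le_continuous _ _ _ T `|T|) => // x y.
by rewrite -bopB bop_norm_le.
Qed.

Lemma compact_operator_comp (R : realType) (V : normedModType R[i])
    (S T : bop V) : compact_operator T -> compact_operator (bop_comp S T).
Proof.
move=> cT; rewrite /compact_operator -precompactE.
apply: (@precompact_subset _ _ (S @` closure (T @` [set x | `|x| <= 1]))).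
  move=> _ [x x1 <-]; exists (T x) => //.
  by apply: subset_closure; exists x.
apply: compact_precompact; first exact: norm_hausdorff.
apply: continuous_compact => //; apply: continuous_subspaceT.
exact: bop_continuous.
Qed.

(** Relative compactness in operator norm, by an Arzela-Ascoli argument.
    Pointwise, an ultrafilter on the set below is Cauchy because the values at
    a vector of the unit ball lie in the compact set C.  The domination by T
    makes the operators phi a equicontinuous functions of T x rather than of x,
    and T x ranges over a relatively compact set, so that the ultrafilter is
    Cauchy uniformly on the unit ball, that is, in operator norm.  Its limit
    in A stays in the set, which is closed. *)
Lemma compact_dominated_operators (R : realType)
    (A : completeNormedModType R[i]) (V : normedModType R[i])
    (phi : A -> bop V) (T : bop V) (C : set V) (r : R[i]) :
  linear phi -> (forall a, `|phi a| = `|a|) ->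
  compact_operator T -> compact C -> 0 < r ->
  compact [set a | forall x, (`|x| <= 1 -> C (phi a x)) /\
                             `|phi a x| <= r * `|T x|].
Proof.
move=> lphi nphi cT cC r0; set E := [set a | _].
have phiB a b x : phi (a - b) x = phi a x - phi b x.
  by rewrite addrC -[- b]scaleN1r lphi /= scaleN1r addrC.
have evC x : continuous (fun a => phi a x).
  apply: (@dist_le_continuous _ _ _ _ `|x|) => // a b.
  by rewrite -phiB mulrC -nphi bop_norm_le.
have clC : closed C by apply: compact_closed => //; exact: norm_hausdorff.
have clE : closed E.
  have -> : E = \bigcap_x ([set a | `|x| <= 1 -> C (phi a x)] `&`
                  (fun a => phi a x) @^-1` [set v | `|v| <= r * `|T x|]).
    by apply/seteqP; split=> a Ea x => [_|]; exact: Ea.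
  apply: closed_bigI => x _; apply: closedI.
    have [x1|nx1] := boolP (`|x| <= 1); last first.
      rewrite (_ : [set a | _] = setT); first exact: closedT.
      by apply/seteqP; split.
    rewrite (_ : [set a | _] = (fun a => phi a x) @^-1` C).
      by apply: closed_comp => [a _|//]; exact: evC.
    by apply/seteqP; split=> a; [move/(_ isT)|move=> ? _].
  apply: closed_comp => [a _|]; first exact: evC.
  by apply: closed_norm_le; rewrite mulr_ge0 // ltW.
rewrite compact_ultra => F FU FE; have PF := @ultra_proper _ _ FU.
have cF : cauchy F.
  apply/cauchy_ballP => e e0.
  have evCauchy (x0 : V) (d : R[i]) : 0 < d -> `|x0| <= 1 ->
      exists p, F [set a | `|p - phi a x0| < d].
    move=> d0 x01; pose ev a := phi a x0.
    have evFC : (ev @ F) C.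
      by apply: (@filterS _ F _ E) => // a /(_ x0)[+ _]; exact.
    have [p [Cp clp]] := cC _ _ evFC.
    exists p; set B := [set a | _].
    have [//|nB] := in_ultra_setVsetC B FU.
    have evnB : (ev @ F) (ev @` (~` B)).
      by apply: (@filterS _ F _ (~` B)) => // a nBa; exists a.
    have [_ [[a nBa <-] qB]] := clp _ _ evnB (nbhsx_ballx p d d0).
    by case: nBa; move: qB; rewrite -ball_normE.
  have /compact_near_coveringP cov := cT.
  (* The uniform estimate is local in h = T x, so that it can be propagated
     from a neighbourhood of each h to the whole compact set. *)
  pose Q (ab : A * A) h := forall x, `|x| <= 1 -> T x = h ->
    `|phi ab.1 x - phi ab.2 x| <= e / 2.
  pose G := filter_prod F F.
  have QG : \forall ab \near G, closure (T @` [set x | `|x| <= 1]) `<=` Q ab.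
    (* The four terms of the splitting below are each at most e / 8: with x0
       such that T x0 is d-close to h, the points T x and T x0 are at most
       2 d apart, and 2 d r = e / 8. *)
    apply: cov => h hK; pose d := e / (16 * r).
    have d0 : 0 < d by rewrite !divr_gt0 ?mulr_gt0.
    have [_ [[x0 x01 <-]]] := hK _ (nbhsx_ballx _ _ d0).
    rewrite -ball_normE /= => hx0.
    have [p Fp] := evCauchy x0 (e / 8) (divr_gt0 e0 (ltr0n _ 8)) x01.
    pose D := E `&` [set a | `|p - phi a x0| < e / 8].
    have FD : F D by exact: filterI.
    exists (ball h d, D `*` D).
      by split; [exact: nbhsx_ballx|exists (D, D)].
    move=> [h' [a b]] [/= hh' [[Ea pa] [Eb pb]]] x x1 Txh'.
    rewrite -ball_normE /= in hh'.
    have Txx0 : `|T (x - x0)| <= d + d.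
      rewrite bopB Txh' distrC -(subrKA h) ltW //.
      by apply: le_lt_trans (ler_normD _ _) _; rewrite ltrD // distrC.
    have tail c : E c -> `|phi c (x - x0)| <= e / 8.
      move=> Ec; apply: le_trans (Ec (x - x0)).2 _.
      have -> : e / 8 = r * (d + d).
        by rewrite /d; field; rewrite gt_eqF.
      by rewrite ler_wpM2l // ltW.
    have -> : phi a x - phi b x = phi a (x - x0) - (p - phi a x0)
        + ((p - phi b x0) - phi b (x - x0)).
      by rewrite !bopB !opprB !subrKA.
    have -> : e / 2 = e / 8 + e / 8 + (e / 8 + e / 8) by field.
    apply: le_trans (ler_normD _ _) _; apply: lerD.
      by apply: le_trans (ler_normB _ _) _; rewrite lerD ?tail // ltW.
    by apply: le_trans (ler_normB _ _) _; rewrite lerD ?tail // ltW.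
  apply: filterS QG => -[a b] Qab; rewrite -ball_normE /=.
  apply: le_lt_trans (_ : e / 2 < e); last first.
    by rewrite ltr_pdivrMr // ltr_pMr // ltr1n.
  rewrite -nphi; apply: bop_norm_bound => x x1; rewrite phiB.
  by apply: (Qab (T x)) => //; apply: subset_closure; exists x.
have /cvg_ex[p Fp] : cvg F by exact: cauchy_cvg.
exists p; split => //.
exact: (@closed_cvg _ _ F _ id E clE FE p Fp).
Qed.

(** With T = phi a, the operator phi (a x a) = T (phi x) T takes values in a
    multiple of the image of the unit ball under T, because of the left factor
    T, and is dominated by a multiple of T, because of the right one. *)
Lemma compact_element_of_compact_image (R : realType)
    (A : banachAlgType R[i]) (V : normedModType R[i]) (phi : A -> bop V)
    (a : A) :
  linear phi -> {morph phi : x y / x ** y} -> (forall x, `|phi x| = `|x|) ->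
  compact_operator (phi a) -> compact_elements A a.
Proof.
move=> lphi mphi nphi Ka; set T := phi a.
have phiaxa x y : phi (a ** x ** a) y = T (phi x (T y)).
  by rewrite !mphi.
(* Adding 1 keeps M invertible when T = 0. *)
pose M : R[i] := `|T| + 1; have M0 : 0 < M by rewrite ltr_wpDl.
pose MT : bop V := bop_comp (M *: bop_id V) T.
have cMT : compact_operator MT by exact: compact_operator_comp.
rewrite /compact_elements /= /compact_operator -precompactE.
have := compact_dominated_operators lphi nphi Ka cMT M0.
move=> /(compact_precompact (@norm_hausdorff _ _)).
apply: precompact_subset => _ [x x1 <-] y.
have Tphi z : `|phi x z| <= `|z|.
  apply: le_trans (bop_norm_le _ _) _.
  by rewrite -[leRHS]mul1r ler_wpM2r // nphi.
rewrite phiaxa; split=> [y1|]; last first.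
  apply: le_trans (bop_norm_le T _) _; apply: ler_pM => //.
  by rewrite lerDl.
apply: subset_closure; exists (M^-1 *: phi x (T y)).
  rewrite /= normrZ normfV (gtr0_norm M0) mulrC ler_pdivrMr // mul1r.
  apply: le_trans (Tphi _) _; apply: le_trans (bop_norm_le T _) _.
  by rewrite /M -[leRHS]mulr1 ler_pM // lerDl.
by rewrite -[LHS]/(M *: T _) bopZ scalerA divff ?gt_eqF // scale1r.
Qed.

Lemma Kell2_0 (R : realType) : Kell2 R 0.
Proof.
rewrite /Kell2 /= /compact_operator -precompactE.
apply: (@precompact_subset _ _ [set 0]); first by move=> _ [x _ <-].
by apply: compact_precompact; [exact: norm_hausdorff|exact: compact_set1].
Qed.

Lemma universally_embeddable_offI (R : realType) (A : uniformAlgType R[i])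
    (Y : set (Bell2 R)) :
  Bell2_embeddable A -> Y 0 ->
  (forall (phi : A -> Bell2 R) a,
     is_Bell2_embedding phi -> Y (phi a) -> a = 0) ->
  universally_embeddable_off Y A.
Proof.
move=> [psi psi_emb] Y0 offY.
have off (phi : A -> Bell2 R) :
    is_Bell2_embedding phi -> range phi `&` Y = [set 0].
  move=> emb; have [lphi _ _] := emb.
  have phi0 : phi 0 = 0.
    by have := lphi (-1) 0 0; rewrite scaler0 addr0 scaleN1r addNr.
  apply/seteqP; split=> [_ [[a _ <-] Ya]|_ ->].
    by rewrite /= (offY _ _ emb Ya).
  by split => //; exists 0.
by split=> //; exists psi; split => //; exact: off.
Qed.

(** Modulo the compact operators phi a is the scalar k, hence b a and k b have
    the same image for every b; and phi is injective modulo the compacts. *)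
Lemma unital_of_mod_compact_scalar (R : realType) (A : uniformAlgType R[i])
    (phi : A -> Bell2 R) (a : A) (S : Bell2 R) (k : R[i]) :
  is_Bell2_embedding phi -> (forall b, Kell2 R (phi b) -> b = 0) ->
  Kell2 R S -> k != 0 -> phi a = S + k *: bop_id (ell2 R) -> unital A.
Proof.
move=> [lphi mphi _] offK KS k0 phia; exists (k^-1 *: a).
have mul_id (T : Bell2 R) : T ** bop_id (ell2 R) = T by exact: val_inj.
suff unitr b : b ** (k^-1 *: a) = b by move=> b; rewrite amulC.
rewrite amulZr; apply: (scalerI k0); rewrite scalerA divff // scale1r.
apply/eqP; rewrite -subr_eq0; apply/eqP; apply: offK.
have -> : phi (b ** a - k *: b) = phi b ** S.
  rewrite addrC -scaleNr lphi mphi phia amulDr amulZr mul_id.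
  by rewrite scaleNr addrC addrK.
exact: compact_operator_comp.
Qed.

Theorem corollary2p14 (R : realType) (A : uniformAlgType R[i])
    (A_embeddable : Bell2_embeddable A)
    (KA0 : compact_elements A = [set 0]) :
  universally_embeddable_off (Kell2 R) A /\
  (~ unital A -> universally_embeddable_off (Kell2_tilde R) A).
Proof.
have offK (phi : A -> Bell2 R) a :
    is_Bell2_embedding phi -> Kell2 R (phi a) -> a = 0.
  move=> [lphi mphi nphi] Ka; suff : compact_elements A a by rewrite KA0.
  exact: (compact_element_of_compact_image lphi).
split.
  by apply: universally_embeddable_offI => //; exact: Kell2_0.
move=> nonunital; apply: universally_embeddable_offI => // [|phi a emb].
  by exists 0; [exact: Kell2_0|exists 0; rewrite ?scale0r ?addr0].
move=> [S KS [k _ Ska]].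
have [k0|k0] := eqVneq k 0.
  by apply: (offK _ _ emb); rewrite -Ska k0 scale0r addr0.
exfalso; apply: nonunital.
apply: (unital_of_mod_compact_scalar emb _ KS k0 (esym Ska)) => b.
exact: offK.
Qed.
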